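(* For every nonnegative integer $n$, $$\sum_{F\in F_n}\mathbf{q}^{\operatorname{tinv}(F)}c^{\operatorname{tree}(F)}=\sum_{P\in PF_n}\mathbf{q}^{\operatorname{tjump}(P)}c^{\operatorname{critic}(P)},$$ where $\mathbf{q}=(q_0,q_1,\dots,q_n)$ are indeterminates and $\mathbf{q}^{(v_0,\dots,v_n)}=q_0^{v_0}q_1^{v_1}\cdots q_n^{v_n}$.
   Context: $F_n$ is the set of rooted forests on the vertex set $\{1,\dots,n\}$ (graphs whose components are trees, each with a distinguished root). A vertex $j$ is a descendant of $i$ if $j\neq i$ and $i$ lies on the path from the root of its component to $j$. $\operatorname{inv}(F:v)$ is the number of descendants $x$ of $v$ with $x<v$; $\operatorname{lead}_i(F)$ is the number of vertices $v$ with $\operatorname{inv}(F:v)=i$; $\operatorname{tinv}(F)=(\operatorname{lead}_0(F),\dots,\operatorname{lead}_n(F))$; $\operatorname{tree}(F)$ is the number of trees of $F$. Parking algorithm: for a sequence $(p_1,\dots,p_n)$ of positive integers, cars $1,\dots,n$ park in turn, car $c$ taking the first empty space among $p_c,p_c+1,\dots$; let $q_c$ be its space. $PF_n$ is the set of such sequences with all $q_c\le n$ (parking functions). $\operatorname{jump}(P:c)=q_c-p_c$; $\operatorname{lucky}_i(P)$ is the number of cars with $\operatorname{jump}(P:c)=i$; $\operatorname{tjump}(P)=(\operatorname{lucky}_0(P),\dots,\operatorname{lucky}_n(P))$. A car $c$ is critical if at the moment it parks all spaces $q_c+1,\dots,n$ are occupied; $\operatorname{critic}(P)$ is the number of critical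 cars. *)

(* Defs.v *)
From HB Require Import structures.
From mathcomp Require Import all_boot all_order all_algebra.
From mathcomp Require Import mpoly.
Set Implicit Arguments. Unset Strict Implicit. Unset Printing Implicit Defensive.
Import GRing.Theory.

(* Vertex k+1 of {1,...,n} is represented by k : 'I_n (order preserved).
   A rooted forest is encoded by its parent map: parent v = None iff v is a
   root, otherwise Some (parent of v); acyclicity: following parents from any
   vertex reaches a root, i.e. after n steps we have left the vertex set. *)
Definition anc n (f : {ffun 'I_n -> option 'I_n}) (k : nat) (v : 'I_n) : option 'I_n :=
  iter k (fun o => obind f o) (Some v).

Definition is_forest n (f : {ffun 'I_n -> option 'I_n}) : bool :=
  [forall v : 'I_n, anc f n v == None].

Definition descendant n (f : {ffun 'I_n -> option 'I_n}) (j i : 'I_n) : bool :=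
  (j != i) && [exists k : 'I_n.+1, anc f k j == Some i].

Definition inv n (f : {ffun 'I_n -> option 'I_n}) (v : 'I_n) : nat :=
  #|[set x : 'I_n | descendant f x v && (x < v)]|.

Definition lead n (f : {ffun 'I_n -> option 'I_n}) (i : nat) : nat :=
  #|[set v : 'I_n | inv f v == i]|.

Definition tree n (f : {ffun 'I_n -> option 'I_n}) : nat :=
  #|[set v : 'I_n | f v == None]|.

Definition first_free (occ : seq nat) (p : nat) : nat :=
  p + find (fun k => (p + k) \notin occ) (iota 0 (size occ).+1).

Definition spots (ps : seq nat) : seq nat :=
  foldl (fun qs p => rcons qs (first_free qs p)) [::] ps.

Definition is_parking_function (n : nat) (ps : seq nat) : bool :=
  [&& size ps == n, all (fun p => 0 < p) ps & all (fun q => q <= n) (spots ps)].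

Definition jump (ps : seq nat) (c : nat) : nat := nth 0 (spots ps) c - nth 0 ps c.

Definition lucky (ps : seq nat) (i : nat) : nat :=
  count (fun c => jump ps c == i) (iota 0 (size ps)).

Definition critical (n : nat) (ps : seq nat) (c : nat) : bool :=
  let qs := spots ps in
  let q := nth 0 qs c in
  all (fun s => s \in take c qs) (iota q.+1 (n - q)).

Definition critic (n : nat) (ps : seq nat) : nat :=
  count (critical n ps) (iota 0 (size ps)).

(* A parking function in PF_n has all entries in {1..n}; we enumerate candidate
   sequences as g : 'I_n -> 'I_n with p_c = g c + 1. *)
Definition pref_seq n (g : {ffun 'I_n -> 'I_n}) : seq nat :=
  [seq (g c).+1 | c <- enum 'I_n].

Definition qvar n (i : 'I_n.+1) : {mpoly int[n.+2]} := 'X_(widen_ord (leqnSn n.+1) i).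
Definition cvar n : {mpoly int[n.+2]} := 'X_(@ord_max n.+1).

(* Main.v *)
Require Import Defs.
From mathcomp Require Import all_boot all_order all_algebra.
From mathcomp Require Import mpoly.
From mathcomp Require Import zify.
Set Implicit Arguments. Unset Strict Implicit. Unset Printing Implicit Defensive.
Import GRing.Theory.
Local Open Scope ring_scope.

(* Write G_n(c) for either side and [k] = q_0 + ... + q_(k-1).  Both satisfy
   G_(n+1)(c) = sum_(j <= n) binom(n,j) c [j+1] G_j(1) G_(n-j)(c).
   For forests, cut out the tree containing a fixed vertex: it has j+1 vertices,
   its root has rank i in it for exactly one choice of the root for each i <= j,
   and deleting the root leaves an arbitrary forest.  For parking functions, look
   at the space j+1 taken by the last car: it is critical and jumps over any of
   0, ..., j spaces; the j cars on its left and the n-j cars on its right park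
   independently, and those on the left are never critical. *)

(** * Reachability along parents, and forests on a subset *)

Definition parent_rel n (f : {ffun 'I_n -> option 'I_n}) : rel 'I_n :=
  fun x y => f x == Some y.

Section Reach.
Variable n : nat.
Implicit Types (f g : {ffun 'I_n -> option 'I_n}) (v w r : 'I_n) (B S : {set 'I_n}).

Lemma anc_path f v p :
  path (parent_rel f) v p -> anc f (size p) v = Some (last v p).
Proof.
elim/last_ind: p => [//|p x IH]; rewrite rcons_path => /andP[/IH e /eqP h].
by rewrite size_rcons last_rcons /anc iterS -/(anc f _ _) e.
Qed.

Lemma anc_connect f k v w : anc f k v = Some w -> connect (parent_rel f) v w.
Proof.
elim: k w => [|k IH] w; first by case=> ->.
rewrite /anc iterS -/(anc f k v); case e: (anc f k v) => [u|//] /= h.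
by apply: connect_trans (IH _ e) (connect1 _); apply/eqP.
Qed.

(** A duplicate-free path has fewer than [n] edges, so the bounds on the number of steps in
    [descendant] and [is_forest] lose nothing. *)
Lemma connect_anc f v w : connect (parent_rel f) v w ->
  exists2 k, (k < n)%N & anc f k v = Some w.
Proof.
case/connectP=> p0 p0P ->; case/shortenP: p0P => p pP up _.
exists (size p); last exact: anc_path.
by have := max_card (mem (v :: p)); rewrite (card_uniqP up) card_ord.
Qed.

Lemma descendantE f v w :
  descendant f v w = (v != w) && connect (parent_rel f) v w.
Proof.
rewrite /descendant; congr (_ && _); apply/existsP/idP => [[k /eqP]|].
  exact: anc_connect.
case/connect_anc=> k kn e; have kn' : (k < n.+1)%N by rewrite ltnW.
by exists (Ordinal kn'); apply/eqP.
Qed.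

Lemma anc_None f k l v : (k <= l)%N -> anc f k v = None -> anc f l v = None.
Proof.
move/subnK <- => e; rewrite /anc iterD -/(anc f k v) e.
by elim: (l - k)%N => //= i ->.
Qed.

(** The last vertex met before the iteration leaves the vertex set is a root. Conversely, a root
    reached in [k < n] steps makes the iteration leave at step [k.+1], hence by step [n]. *)
Lemma is_forestP f :
  reflect (forall v, exists2 r, f r = None & connect (parent_rel f) v r)
          (is_forest f).
Proof.
apply: (iffP forallP) => [h v|h v].
  suff aux k : anc f k v = None ->
      exists2 r, f r = None & connect (parent_rel f) v r by apply/(aux n)/eqP.
  elim: k => [//|k IH].
  case e: (anc f k v) => [u|]; last by move=> _; exact: IH.
  rewrite /anc iterS -/(anc f k v) e /= => fu.
  by exists u => //; exact: anc_connect e.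
have [r fr /connect_anc[k kn e]] := h v.
by apply/eqP/(@anc_None _ k.+1) => //; rewrite /anc iterS -/(anc f k v) e.
Qed.

Lemma root_connect f r w : f r = None -> connect (parent_rel f) r w = (w == r).
Proof.
move=> fr; apply/connectP/eqP => [[[|x p]]//=|->]; last by exists [::].
by rewrite {1}/parent_rel fr.
Qed.

Lemma connect_step f u v w : f u = Some v ->
  connect (parent_rel f) u w = (w == u) || connect (parent_rel f) v w.
Proof.
move=> fu; apply/idP/orP => [/connectP[[|x p]]//=|[/eqP->|]].
- by move=> _ ->; left.
- rewrite {1}/parent_rel fu => /andP[/eqP[->] pP ->]; right.
  by apply/connectP; exists p.
- exact: connect0.
- by apply: connect_trans; apply: connect1; apply/eqP.
Qed.

Lemma connect_ind_to f w (P : 'I_n -> Prop) : P w ->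
  (forall u v, u != w -> f u = Some v -> connect (parent_rel f) v w -> P v -> P u) ->
  forall u, connect (parent_rel f) u w -> P u.
Proof.
move=> Pw Ps u /connectP[p]; elim: p u => [|x p IH] u /=.
  by move=> _ <-.
case/andP=> /eqP fu pP e; have [->//|uw] := eqVneq u w.
by apply: Ps uw fu _ (IH _ pP e); apply/connectP; exists p.
Qed.

Definition parent_closed f (X : pred 'I_n) :=
  forall u v, X u -> f u = Some v -> X v.

Lemma connect_parent_closed f X u w : parent_closed f X ->
  connect (parent_rel f) u w -> X u -> X w.
Proof.
move=> cX /connectP[p]; elim: p u => [|x p IH] u /=; first by move=> _ ->.
by case/andP=> /eqP fu pP e Xu; apply: IH pP e (cX _ _ Xu fu).
Qed.

(** A path starting in a parent-closed set never leaves it, so only the values of the parent map on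
    that set matter. *)
Lemma connect_agree f g X u w : parent_closed f X ->
  (forall v, X v -> f v = g v) -> X u ->
  connect (parent_rel f) u w = connect (parent_rel g) u w.
Proof.
move=> cX fg Xu; have cX' : parent_closed g X.
  by move=> a b Xa; rewrite -fg //; exact: cX.
apply/connectP/connectP => -[p]; elim: p u Xu => [|x p IH] u Xu /=.
- by move=> _ ->; exists [::].
- case/andP=> /eqP fu pP e; have [|p' p'P e'] := IH x _ pP e.
    exact: cX Xu fu.
  by exists (x :: p') => //=; rewrite p'P /parent_rel -fg // fu eqxx.
- by move=> _ ->; exists [::].
- case/andP=> /eqP fu pP e; have [|p' p'P e'] := IH x _ pP e.
    exact: cX' Xu fu.
  by exists (x :: p') => //=; rewrite p'P /parent_rel fg // fu eqxx.
Qed.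

(* Vertices outside [S] are required to be isolated roots, so that forests on
   subsets live in the same type and keep their labels. *)
Definition forest_on S f :=
  is_forest f &&
  [forall v, if f v is Some u then (v \in S) && (u \in S) else true].

Lemma forest_onP S f : reflect
  (is_forest f /\ forall v u, f v = Some u -> v \in S /\ u \in S)
  (forest_on S f).
Proof.
apply: (iffP andP) => -[ff /=]; split=> //.
  by move=> v u e; have /forallP/(_ v) := b; rewrite e => /andP.
by apply/forallP => v; case e: (f v) => [u|//]; apply/andP; exact: (b v).
Qed.

(** * Cutting a tree out of a forest, deleting its root, and the inverse operation *)

Definition glue B r f1 f2 : {ffun 'I_n -> option 'I_n} :=
  [ffun v => if v == r then None
             else if v \in B then Some (odflt r (f1 v)) else f2 v].

(** The children of [r] become roots; this undoes [odflt r] in [glue], which hangs the roots of [f1]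
    below [r]. *)
Definition subroot B r f : {ffun 'I_n -> option 'I_n} :=
  [ffun v => if (v \in B) && (f v != Some r) then f v else None].

Definition outside B f : {ffun 'I_n -> option 'I_n} :=
  [ffun v => if v \in B then None else f v].

Definition below f r : {set 'I_n} := [set v | connect (parent_rel f) v r].

(** The default [v] is never returned when [f] is a forest, by [root_ofP]. *)
Definition root_of f v : 'I_n :=
  odflt v [pick r | (f r == None) && connect (parent_rel f) v r].

Lemma root_ofP f v : is_forest f ->
  f (root_of f v) = None /\ connect (parent_rel f) v (root_of f v).
Proof.
move/is_forestP/(_ v) => [r fr vr]; rewrite /root_of.
case: pickP => [x /andP[/eqP]//|/(_ r)]; by rewrite fr vr.
Qed.

(** Parents are unique, so the climb from [v] is forced and stops at the first root. *)
Lemma root_uniq f v r r' : f r = None -> f r' = None ->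
  connect (parent_rel f) v r -> connect (parent_rel f) v r' -> r = r'.
Proof.
move=> fr fr' vr; move: v vr.
apply: (@connect_ind_to f r (fun v => connect (parent_rel f) v r' -> r = r')).
  by rewrite root_connect // => /eqP.
move=> u v _ fu _ IH; rewrite (connect_step _ fu) => /orP[/eqP e|//].
by rewrite -e fr' in fu.
Qed.


Lemma forest_on_None S f v : forest_on S f -> v \notin S -> f v = None.
Proof.
case/forest_onP=> _ fS vS; case e: (f v) => [u|//].
by have [] := fS _ _ e; rewrite (negbTE vS).
Qed.

Lemma forest_on_closed S f : forest_on S f -> parent_closed f (mem S).
Proof. by case/forest_onP=> _ fS u v _ /fS[]. Qed.

Section Glue.
Variables (B S : {set 'I_n}) (r : 'I_n) (f1 f2 : {ffun 'I_n -> option 'I_n}).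
Hypotheses (rB : r \in B) (BS : B \subset S).
Hypotheses (f1P : forest_on (B :\ r) f1) (f2P : forest_on (S :\: B) f2).
Let f := glue B r f1 f2.

Lemma glue_root : f r = None.
Proof. by rewrite ffunE eqxx. Qed.

Lemma glue_in v : v \in B -> v != r -> f v = Some (odflt r (f1 v)).
Proof. by move=> vB vr; rewrite ffunE (negbTE vr) vB. Qed.

Lemma glue_out v : v \notin B -> f v = f2 v.
Proof.
move=> vB; rewrite ffunE (negbTE vB).
by case: eqP vB rB => // -> /negbTE ->.
Qed.

Lemma glue_closed_out : parent_closed f (fun v => v \notin B).
Proof.
move=> u v uB; rewrite glue_out // => /(proj2 (forest_onP _ _ f2P)).
by rewrite !inE => -[_ /andP[]].
Qed.

Lemma glue_connect_out v w : v \notin B ->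
  connect (parent_rel f) v w = connect (parent_rel f2) v w.
Proof. by move=> vB; exact: connect_agree glue_closed_out glue_out vB. Qed.

(** Since [r] has no parent, a path to another target cannot pass through [r], and all its edges
    come from [f1]. *)
Lemma glue_connect_in v w : v \in B -> w != r ->
  connect (parent_rel f) v w = connect (parent_rel f1) v w.
Proof.
move=> vB wr; apply/idP/idP => [vw|]; last first.
  move: v {vB}; apply: connect_ind_to => [|u v _ f1u _]; first exact: connect0.
  have [] := proj2 (forest_onP _ _ f1P) _ _ f1u; rewrite !inE => /andP[ur uB] _.
  by apply: connect_trans; apply: connect1; rewrite /parent_rel glue_in // f1u.
move: v vw vB; apply: connect_ind_to => [_|u v _ fu vw IH uB]; first exact: connect0.
have ur : u != r by apply: contra_eq_neq fu => ->; rewrite glue_root.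
move: fu; rewrite glue_in //; case f1u: (f1 u) => [x|] /= -[ex]; last first.
  by move: vw; rewrite -ex root_connect ?glue_root // (negbTE wr).
rewrite {x}ex in f1u; apply: connect_trans (IH _); first exact/connect1/eqP.
by have [_] := proj2 (forest_onP _ _ f1P) _ _ f1u; rewrite !inE => /andP[].
Qed.

(** A vertex of [B] other than [r] climbs in [f1] to a root of [f1], whose parent after gluing is
    [r]; the complement of [B] is parent-closed. *)
Lemma glue_connect_root v : connect (parent_rel f) v r = (v \in B).
Proof.
apply/idP/idP => [|vB].
  apply: contraTT => vB; apply/negP.
  by move=> /(connect_parent_closed glue_closed_out)/(_ vB)/negP.
have [->|vr] := eqVneq v r; first exact: connect0.
have [/is_forestP/(_ v)[r1 fr1 vr1] _] := forest_onP _ _ f1P.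
have : r1 \in B :\ r.
  by apply: (connect_parent_closed (forest_on_closed f1P) vr1); rewrite !inE vr.
rewrite !inE => /andP[r1r r1B].
apply: (@connect_trans _ _ r1); first by rewrite glue_connect_in.
by apply: connect1; rewrite /parent_rel glue_in // fr1.
Qed.

Lemma glue_forest : forest_on S f.
Proof.
apply/forest_onP; split=> [|v u].
  apply/is_forestP => v; have [vB|vB] := boolP (v \in B).
    by exists r; rewrite ?glue_root // glue_connect_root.
  have [/is_forestP/(_ v)[r2 fr2 vr2] _] := forest_onP _ _ f2P.
  rewrite -glue_connect_out // in vr2; exists r2 => //.
  by rewrite glue_out // (connect_parent_closed glue_closed_out vr2).
have [vB|vB] := boolP (v \in B); last first.
  rewrite glue_out // => /(proj2 (forest_onP _ _ f2P)).
  by rewrite !inE => -[/andP[_ ->] /andP[_ ->]].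
have [->|vr] := eqVneq v r; first by rewrite glue_root.
rewrite glue_in // => -[<-]; rewrite (subsetP BS v vB); split=> //.
case f1v: (f1 v) => [x|] /=; last exact: (subsetP BS).
have [_] := proj2 (forest_onP _ _ f1P) _ _ f1v.
by rewrite !inE => /andP[_ /(subsetP BS)].
Qed.

Lemma below_glue : below f r = B.
Proof. by apply/setP => v; rewrite inE glue_connect_root. Qed.

Lemma root_of_glue m : m \in B -> root_of f m = r.
Proof.
rewrite -glue_connect_root => mr; have [ff _] := forest_onP _ _ glue_forest.
by have [? ?] := root_ofP m ff; apply: root_uniq mr => //; exact: glue_root.
Qed.

Lemma subroot_glue : subroot B r f = f1.
Proof.
apply/ffunP => v; rewrite ffunE; have [vB|vB] /= := boolP (v \in B); last first.
  by rewrite (forest_on_None f1P) // !inE negb_and vB orbT.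
have [->|vr] := eqVneq v r.
  by rewrite glue_root /= (forest_on_None f1P) // !inE eqxx.
rewrite glue_in //; case f1v: (f1 v) => [x|] /=; last by rewrite eqxx.
have [_] := proj2 (forest_onP _ _ f1P) _ _ f1v.
rewrite !inE => /andP[xr _]; case: eqP => // -[xr'].
by rewrite xr' eqxx in xr.
Qed.

Lemma outside_glue : outside B f = f2.
Proof.
apply/ffunP => v; rewrite ffunE; case: ifPn => [vB|vB]; last by rewrite glue_out.
by rewrite (forest_on_None f2P) // !inE vB.
Qed.

Lemma inv_glue_in v : v \in B :\ r -> Defs.inv f v = Defs.inv f1 v.
Proof.
rewrite !inE => /andP[vr vB]; apply: eq_card => x; rewrite !inE !descendantE.
have [xB|xB] := boolP (x \in B); first by rewrite glue_connect_in.
(* For [x] outside [B]: in [f] its ancestors stay outside [B], and in [f1] it is an isolated root,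
   so it is a descendant of [v] on neither side. *)
have -> : connect (parent_rel f) x v = false.
  by apply/negP => /(connect_parent_closed glue_closed_out)/(_ xB)/negP.
rewrite root_connect 1?eq_sym ?andbN //.
  by rewrite eq_sym; case: eqP.
by apply: forest_on_None f1P _; rewrite !inE negb_and xB orbT.
Qed.

Lemma inv_glue_out v : v \notin B -> Defs.inv f v = Defs.inv f2 v.
Proof.
move=> vB; apply: eq_card => x; rewrite !inE !descendantE.
have [xB|xB] := boolP (x \in B); last by rewrite glue_connect_out.
have xv : v != x by apply: contraNneq vB => ->.
rewrite [connect (parent_rel f2) _ _]root_connect; last first.
  by apply: forest_on_None f2P _; rewrite !inE xB.
have vr : v != r by apply: contraNneq vB => ->.
rewrite glue_connect_in // (negbTE xv) andbF.
have -> : connect (parent_rel f1) x v = false; last by rewrite andbF.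
have [->|xr] := eqVneq x r.
  rewrite root_connect ?(negbTE vr) // (forest_on_None f1P) //.
  by rewrite !inE eqxx.
apply/negP => /(connect_parent_closed (forest_on_closed f1P)) /=.
by rewrite !inE xr xB (negbTE vB) andbF => /(_ isT).
Qed.

Lemma inv_glue_root : Defs.inv f r = #|[set x in B :\ r | (x < r)%N]|.
Proof.
by apply: eq_card => x; rewrite !inE descendantE glue_connect_root.
Qed.

End Glue.

Section Unglue.
Variables (S : {set 'I_n}) (r : 'I_n) (f : {ffun 'I_n -> option 'I_n}).
Hypotheses (fP : forest_on S f) (rS : r \in S) (fr : f r = None).
Let B := below f r.

Lemma root_in_below : r \in B.
Proof. by rewrite inE connect0. Qed.

Lemma below_sub : B \subset S.
Proof.
apply/subsetP => v; rewrite inE => vr; apply: contraTT vr => vS.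
rewrite root_connect ?(forest_on_None fP) //.
by apply: contraNneq vS => <-.
Qed.

Lemma belowS u v : u != r -> f u = Some v -> (u \in B) = (v \in B).
Proof. by move=> ur fu; rewrite !inE (connect_step _ fu) eq_sym (negbTE ur). Qed.

Lemma subroot_forest : forest_on (B :\ r) (subroot B r f).
Proof.
set g := subroot B r f.
have gE v u : g v = Some u -> [/\ v \in B, v != r, f v = Some u & u != r].
  rewrite ffunE; case: ifP => // /andP[vB fv] fvu.
  split=> //; first by apply: contra_eq_neq fvu => ->; rewrite fr.
  by apply: contra_neq fv => <-.
apply/forest_onP; split=> [|v u /gE[vB vr fv ur]]; last first.
  by rewrite !in_setD1 vr ur -(belowS vr fv) vB.
apply/is_forestP => v; have [vB|vB] := boolP (v \in B); last first.
  by exists v; [rewrite ffunE (negbTE vB) | exact: connect0].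
move: (vB); rewrite inE => vr; move: v vr {vB}.
apply: connect_ind_to => [|u v ur fu vr [r1 gr1 vr1]].
  by exists r; [rewrite ffunE fr if_same | exact: connect0].
(* A child of [r] is a root after the cut; any other vertex keeps its parent and inherits the root
   found for it. *)
have [evr|nvr] := eqVneq v r.
  by exists u; [rewrite ffunE fu evr eqxx andbF | exact: connect0].
exists r1 => //; apply: connect_trans vr1; apply: connect1.
rewrite /parent_rel ffunE (belowS ur fu) inE vr fu /=.
by case: (Some v =P Some r) => // -[] /eqP; rewrite (negbTE nvr).
Qed.

Lemma outside_forest : forest_on (S :\: B) (outside B f).
Proof.
have [/is_forestP ff fS] := forest_onP _ _ fP.
have notr u : u \notin B -> u != r.
  by apply: contraNneq => ->; exact: root_in_below.
have cl : parent_closed f (fun v => v \notin B).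
  by move=> u v uB fu; rewrite -(belowS (notr _ uB) fu).
apply/forest_onP; split=> [|v u].
  apply/is_forestP => v; have [vB|vB] := boolP (v \in B).
    by exists v; [rewrite ffunE vB | exact: connect0].
  have [r1 fr1 vr1] := ff v; exists r1; first by rewrite ffunE fr1 if_same.
  rewrite -(connect_agree r1 cl _ vB) // => x xB.
  by rewrite ffunE (negbTE xB).
rewrite ffunE; case: ifPn => // vB fv; have [vS uS] := fS _ _ fv.
by rewrite !in_setD vS uS -(belowS (notr _ vB) fv) vB.
Qed.

Lemma glue_unglue : glue B r (subroot B r f) (outside B f) = f.
Proof.
apply/ffunP => v; rewrite !ffunE; have [->|vr] := eqVneq v r; first by rewrite fr.
case: ifP => vB; rewrite vB //=; case fv: (f v) => [u|] //=.
  by case: (Some u =P Some r) => [[->]|].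
by move: vB; rewrite inE root_connect // eq_sym (negbTE vr).
Qed.

End Unglue.
End Reach.

(** * Sums over elements by rank and over subsets by cardinality *)

Section SetSums.
Variables (R : comNzRingType) (n : nat).
Implicit Types (D B : {set 'I_n}).

(** Induction on the size of [B], removing its maximum: the maximum has rank [#|B| - 1], and its
    removal leaves the other ranks unchanged. *)
Lemma sum_rank (q : nat -> R) B :
  \sum_(r in B) q #|[set y in B :\ r | (y < r)%N]| = \sum_(i < #|B|) q i.
Proof.
have [k] := ubnP #|B|; elim: k B => // k IH B; rewrite ltnS => Bk.
have [->|[b0 b0B]] := set_0Vmem B; first by rewrite big_set0 cards0 big_ord0.
case: (arg_maxnP (fun i : 'I_n => i : nat) b0B) => b /= bB0 bmax.
have bB : b \in B := bB0.
rewrite (big_setD1 b) //= [#|B|](cardsD1 b) bB big_ord_recr /= addrC; congr (_ + _).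
  rewrite -IH; last by move: Bk; rewrite (cardsD1 b) bB.
  apply: eq_bigr => r; rewrite !inE => /andP[rb rB]; congr q.
  apply: eq_card => y; rewrite !inE; case: (y =P b) => [->|] //=.
  by rewrite andbF ltnNge (bmax _ rB) andbF.
congr q; apply: eq_card => y; rewrite !inE.
have [yB|] := boolP (y \in B); last by rewrite !andbF.
by rewrite ltn_neqAle [(y <= b)%N](bmax _ yB) !andbT andbb.
Qed.

Lemma sum_subsets_card D (phi : nat -> R) :
  \sum_(A : {set 'I_n} | A \subset D) phi #|A|
    = \sum_(j < #|D|.+1) phi j *+ 'C(#|D|, j).
Proof.
rewrite (partition_big (fun A : {set 'I_n} => inord #|A| : 'I_(#|D|.+1)) predT) //=.
apply: eq_bigr => j _; rewrite -cards_draws -sumr_const; apply: eq_big => [A|A].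
  rewrite inE; case: (boolP (A \subset D)) => //= AD.
  by rewrite -val_eqE /= inordK // ltnS subset_leq_card.
by case/andP=> AD /eqP <-; rewrite inordK // ltnS subset_leq_card.
Qed.

Lemma sum_subsets_containing D m (phi : nat -> R) : m \in D ->
  \sum_(B : {set 'I_n} | (m \in B) && (B \subset D)) phi #|B|
    = \sum_(j < #|D|) phi j.+1 *+ 'C(#|D|.-1, j).
Proof.
move=> mD; have Dm : #|D| = #|D :\ m|.+1 by rewrite (cardsD1 m) mD.
rewrite Dm /= -(sum_subsets_card (D :\ m) (phi \o succn)) /=.
rewrite (reindex_onto (fun A : {set 'I_n} => m |: A) (fun B => B :\ m)) /=; last first.
  by move=> B /andP[mB _]; rewrite setD1K.
apply: eq_big => [A|A /andP[_ /eqP e]]; last first.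
  have mA : m \notin A by rewrite -e !inE eqxx.
  by rewrite cardsU1 mA.
rewrite setU11 /= subUset sub1set mD /= subsetD1 andbC.
have [mA|mA] := boolP (m \in A); last by rewrite setU1K // eqxx andbC.
rewrite andbF; apply/negP => /andP[/eqP e _].
by move: mA; rewrite -e !inE eqxx.
Qed.

End SetSums.

(** * Recurrence for the weighted sum over forests *)

Section ForestSum.
Variables (R : comNzRingType) (n : nat) (q : nat -> R).
Implicit Types (B S : {set 'I_n}) (x : R).

(** Taking [x = 1] forgets the number of trees, as is needed for the forest left under a deleted
    root: its roots are not roots of the original forest. *)
Definition vertex_weight x (f : {ffun 'I_n -> option 'I_n}) v : R :=
  q (Defs.inv f v) * (if f v == None then x else 1).

Definition forest_sum S x : R :=
  \sum_(f : {ffun 'I_n -> option 'I_n} | forest_on S f)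
     \prod_(v in S) vertex_weight x f v.

Lemma glue_weight x B S r f1 f2 : r \in B -> B \subset S ->
  forest_on (B :\ r) f1 -> forest_on (S :\: B) f2 ->
  \prod_(v in S) vertex_weight x (glue B r f1 f2) v =
  x * q #|[set y in B :\ r | (y < r)%N]| *
  (\prod_(v in B :\ r) vertex_weight 1 f1 v *
   \prod_(v in S :\: B) vertex_weight x f2 v).
Proof.
move=> rB BS f1P f2P; rewrite (big_setID B) /= (setIidPr BS) (big_setD1 r rB) /=.
rewrite -mulrA; congr (_ * (_ * _)).
- by rewrite /vertex_weight (inv_glue_root rB f1P f2P) glue_root eqxx mulrC.
- apply: eq_bigr => v vB; rewrite /vertex_weight (inv_glue_in rB f1P f2P) //.
  move: vB; rewrite in_setD1 => /andP[vr vB].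
  by rewrite glue_in // if_same.
apply: eq_bigr => v; rewrite inE => /andP[vB _].
by rewrite /vertex_weight (inv_glue_out rB f1P f2P) // (glue_out _ _ rB).
Qed.

(* Remove the root [r] of the tree containing [m]; [B] is the vertex set of
   that tree. *)
Lemma forest_sum_decomp m S x : m \in S ->
  forest_sum S x =
  \sum_(B : {set 'I_n} | (m \in B) && (B \subset S)) \sum_(r in B)
    x * q #|[set y in B :\ r | (y < r)%N]|
      * (forest_sum (B :\ r) 1 * forest_sum (S :\: B) x).
Proof.
move=> mS; rewrite pair_big_dep /= /forest_sum.
rewrite (partition_big (fun f => (below f (root_of f m), root_of f m))
  (fun p => [&& m \in p.1, p.1 \subset S & p.2 \in p.1])) /=; last first.
  move=> f fP; have [ff _] := forest_onP _ _ fP; have [fr mr] := root_ofP m ff.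
  rewrite inE mr (below_sub fP) ?root_in_below //.
  exact: connect_parent_closed (forest_on_closed fP) mr mS.
apply: eq_big => [[B r]|[B r] /and3P[/= mB BS rB]]; first by rewrite /= andbA.
rewrite big_distrlr pair_big big_distrr /=.
rewrite (reindex_onto (fun p => glue B r p.1 p.2)
   (fun f => (subroot B r f, outside B f))) /=; last first.
  move=> f /andP[fP /eqP[eB er]]; have [ff _] := forest_onP _ _ fP.
  have [fr mr] := root_ofP m ff; rewrite er in eB fr; rewrite -eB.
  by apply: glue_unglue.
(* The summation condition left by the reindexing: if gluing gives a forest that cuts back to [f1]
   and [f2], these are forests as pieces of a forest; the converse is the round trip through
   [glue]. *)
have pieces f1 f2 : (forest_on S (glue B r f1 f2)
      && ((below (glue B r f1 f2) (root_of (glue B r f1 f2) m),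
           root_of (glue B r f1 f2) m) == (B, r)))
    && ((subroot B r (glue B r f1 f2), outside B (glue B r f1 f2)) == (f1, f2))
    = forest_on (B :\ r) f1 && forest_on (S :\: B) f2.
  apply/idP/andP => [/andP[/andP[fP /eqP[eB er]] /eqP[e1 e2]]|[f1P f2P]].
    have [ff _] := forest_onP _ _ fP; have [fr mr] := root_ofP m ff.
    rewrite er in eB fr; split.
      by have := subroot_forest fr; rewrite eB e1.
    by have := outside_forest r fP; rewrite eB e2.
  rewrite glue_forest // (root_of_glue rB BS f1P f2P mB).
  by rewrite (below_glue rB f1P f2P) (subroot_glue f2 f1P) (outside_glue _ rB f2P) !eqxx.
apply: eq_big => [[f1 f2]|[f1 f2]] /=; rewrite pieces // => /andP[f1P f2P].
exact: glue_weight.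
Qed.

(** [X] and [Y] stand for the values on smaller sets, assumed to depend only on cardinality. The
    choice of the root is then summed by [sum_rank], that of the tree containing a fixed vertex by
    [sum_subsets_containing]. *)
Lemma forest_sum_rec k S x (X Y : nat -> R) : #|S| = k.+1 ->
  (forall B, (#|B| <= k)%N -> forest_sum B 1 = X #|B|) ->
  (forall B, (#|B| <= k)%N -> forest_sum B x = Y #|B|) ->
  forest_sum S x = \sum_(j < k.+1)
    (x * (\sum_(i < j.+1) q i) * (X j * Y (k - j)%N)) *+ 'C(k, j).
Proof.
move=> Sk XP YP; have [m mS] : exists m, m \in S by apply/card_gt0P; rewrite Sk.
(* Here [b] is the size of the tree containing [m]: [b.-1] vertices lie below its root and
   [k.+1 - b] outside the tree. *)
pose phi b := x * (\sum_(i < b) q i) * (X b.-1 * Y (k.+1 - b)%N).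
rewrite (forest_sum_decomp _ mS).
transitivity (\sum_(j < #|S|) phi j.+1 *+ 'C(#|S|.-1, j)); last first.
  by rewrite Sk; apply: eq_bigr => j _; rewrite /phi subSS.
rewrite -(sum_subsets_containing phi mS).
apply: eq_bigr => B /andP[mB BS]; rewrite /phi -sum_rank mulr_sumr mulr_suml.
have B0 : (0 < #|B|)%N by apply/card_gt0P; exists m.
have Bk : (#|B| <= k.+1)%N by rewrite -Sk subset_leq_card.
apply: eq_bigr => r rB; congr (_ * (_ * _)).
  have -> : #|B|.-1 = #|B :\ r| by rewrite (cardsD1 r) rB.
  by apply: XP; move: Bk; rewrite (cardsD1 r) rB.
have e : #|S :\: B| = (k.+1 - #|B|)%N by rewrite cardsD (setIidPr BS) Sk.
by rewrite YP e //; lia.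
Qed.

Lemma forest_sum0 x : forest_sum set0 x = 1.
Proof.
rewrite /forest_sum (big_pred1 [ffun=> None]) ?big_set0 // => f /=.
apply/idP/eqP => [fP|->].
  by apply/ffunP => v; rewrite ffunE (forest_on_None fP) // inE.
apply/forest_onP; split=> [|v u]; last by rewrite ffunE.
by apply/is_forestP => v; exists v; [rewrite ffunE | exact: connect0].
Qed.

End ForestSum.

(** * The parking rule and the spaces it assigns *)

Section FirstFree.
Implicit Types (occ ps : seq nat).

(** Pigeonhole: [(size occ).+1] consecutive spaces cannot all belong to [occ], so the bounded search
    succeeds. *)
Lemma first_free_bounded occ p :
  (find (fun k => (p + k)%N \notin occ) (iota 0 (size occ).+1) < (size occ).+1)%N.
Proof.
rewrite -[X in (_ < X)%N](size_iota 0) -has_find; apply/negPn/negP => /hasPn all_occ.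
have u : uniq [seq (p + k)%N | k <- iota 0 (size occ).+1].
  by rewrite map_inj_uniq ?iota_uniq //; exact: addnI.
have := @uniq_leq_size _ _ occ u; rewrite size_map size_iota ltnn => /(_ _)/notF.
by apply=> x /mapP[k /all_occ/negPn ? ->].
Qed.

Lemma first_free_notin occ p : first_free occ p \notin occ.
Proof.
have lt := first_free_bounded occ p; have h := lt.
rewrite -[X in (_ < X)%N](size_iota 0) -has_find in h.
by have := nth_find 0%N h; rewrite nth_iota.
Qed.

Lemma first_free_ge occ p : (p <= first_free occ p)%N.
Proof. exact: leq_addr. Qed.

Lemma first_free_before occ p y : (p <= y < first_free occ p)%N -> y \in occ.
Proof.
case/andP=> py; rewrite /first_free -{1}(subnKC py) ltn_add2l => lt.
have := before_find 0%N lt; rewrite nth_iota; last first.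
  exact: ltn_trans lt (first_free_bounded occ p).
by rewrite add0n subnKC // => /negbFE.
Qed.

Lemma first_freeP occ p f :
  reflect [/\ (p <= f)%N, f \notin occ & forall y, (p <= y < f)%N -> y \in occ]
          (first_free occ p == f).
Proof.
apply: (iffP eqP) => [<-|[pf focc occf]].
  by split; [exact: first_free_ge|exact: first_free_notin|exact: first_free_before].
case: (ltngtP (first_free occ p) f) => // lt.
  by have := first_free_notin occ p; rewrite occf // first_free_ge.
by move: focc; rewrite (@first_free_before _ p) // pf.
Qed.

Lemma spots_rcons ps p :
  spots (rcons ps p) = rcons (spots ps) (first_free (spots ps) p).
Proof. by rewrite /spots foldl_rcons. Qed.

Lemma size_spots ps : size (spots ps) = size ps.
Proof.
by elim/last_ind: ps => // ps p IH; rewrite spots_rcons !size_rcons IH.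
Qed.

Lemma spots_uniq ps : uniq (spots ps).
Proof.
elim/last_ind: ps => // ps p IH.
by rewrite spots_rcons rcons_uniq IH first_free_notin.
Qed.

Lemma spots_gt0 ps : all (leq 1) ps -> all (leq 1) (spots ps).
Proof.
elim/last_ind: ps => // ps p IH; rewrite spots_rcons !all_rcons => /andP[p0 /IH->].
by rewrite (leq_trans p0) ?first_free_ge.
Qed.

End FirstFree.

(** * Weighted orders of filling a set of spaces *)

Section Filling.
Variables (R : comNzRingType) (n : nat) (q : nat -> R) (c : R).
Implicit Types (O U : {set 'I_n}) (s p : 'I_n).

(* Total weight of the preferences [p] that send a car to the free space [s] when
   the occupied spaces are those of [O]; spaces are numbered from 0. *)
Definition jump_weight O s : R :=
  \sum_(p : 'I_n | (p <= s)%N && [forall y : 'I_n, (p <= y < s)%N ==> (y \in O)])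
     q (s - p)%N.

Definition park_weight O s : R :=
  jump_weight O s * (if [forall y : 'I_n, (s < y)%N ==> (y \in O)] then c else 1).

(* Sum over the orders in which [k] cars can fill [U]; [s] is taken last. *)
Fixpoint fill_rec k U : R :=
  if k is k'.+1 then \sum_(s in U) park_weight (U :\ s) s * fill_rec k' (U :\ s)
  else (U == set0)%:R.

Definition fill_sum U := fill_rec #|U| U.

Lemma fill_sum0 : fill_sum set0 = 1.
Proof. by rewrite /fill_sum cards0 /= eqxx. Qed.

Lemma fill_sumE U : U != set0 ->
  fill_sum U = \sum_(s in U) park_weight (U :\ s) s * fill_sum (U :\ s).
Proof.
rewrite -card_gt0 /fill_sum; case e: #|U| => [//|k] _ /=.
apply: eq_bigr => s sU; congr (_ * fill_rec _ _).
by move: e; rewrite (cardsD1 s) sU => -[].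
Qed.

(** The weight depends on [O] only through the runs of occupied spaces ending just before [s] and
    through whether everything after [s] is full. *)
Lemma park_weight_eq O O' s :
  (forall p : 'I_n, (p <= s)%N ->
     (forall y : 'I_n, (p <= y < s)%N -> y \in O) <->
     (forall y : 'I_n, (p <= y < s)%N -> y \in O')) ->
  ((forall y : 'I_n, (s < y)%N -> y \in O) <->
     (forall y : 'I_n, (s < y)%N -> y \in O')) ->
  park_weight O s = park_weight O' s.
Proof.
move=> hl hr; congr (_ * _); last first.
  congr (if _ then _ else _); apply/forallP/forallP => h y; apply/implyP; apply hr;
    by move=> x; apply/implyP.
apply: eq_bigl => p; case ps: (p <= s)%N => //=.
apply/forallP/forallP => h y; apply/implyP; apply (hl p ps) => x; exact/implyP.
Qed.

(* The two sides of a free space do not interact: orderings of the cars are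
   shuffles of an ordering of the left cars with one of the right cars. *)
Lemma fill_sumU (z : 'I_n) U1 U2 :
  (forall x, x \in U1 -> (x < z)%N) -> (forall x, x \in U2 -> (z < x)%N) ->
  fill_sum (U1 :|: U2)
    = (fill_sum U1 * fill_sum U2) *+ 'C(#|U1| + #|U2|, #|U1|).
Proof.
have [k] := ubnP (#|U1| + #|U2|)%N; elim: k U1 U2 => // k IH U1 U2 lek z1 z2.
have disj : [disjoint U1 & U2].
  apply/pred0P => x /=; apply/negP => /andP[/z1 a /z2 b].
  by have := ltn_trans a b; rewrite ltnn.
have zO1 : z \notin U1 by apply/negP => /z1; rewrite ltnn.
have zO2 : z \notin U2 by apply/negP => /z2; rewrite ltnn.
have [U0|U0] := eqVneq (U1 :|: U2) set0.
  move/eqP: (U0); rewrite setU_eq0 => /andP[/eqP -> /eqP ->].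
  by rewrite setU0 fill_sum0 cards0 mulr1.
have nz : (0 < #|U1| + #|U2|)%N.
  by move: U0; rewrite -card_gt0 cardsU (disjoint_setI0 disj) cards0 subn0.
rewrite fill_sumE // (eq_bigl [predU U1 & U2]); last by move=> x; rewrite !inE.
rewrite bigU //=.
(* The last car parks in [U1]. The [if] counts the shuffles of the remaining cars, and is zero when
   [U1] is empty. *)
have -> : \sum_(s in U1) park_weight ((U1 :|: U2) :\ s) s * fill_sum ((U1 :|: U2) :\ s)
  = (fill_sum U1 * fill_sum U2) *+
      (if #|U1| is a.+1 then 'C(a + #|U2|, a) else 0).
  have [->|U1n] := eqVneq U1 set0; first by rewrite big_set0 cards0 mulr0n.
  rewrite (fill_sumE U1n) mulr_suml -sumrMnl; apply: eq_bigr => s sU1.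
  have s2 : s \notin U2 by rewrite (disjointFr disj sU1).
  have -> : (U1 :|: U2) :\ s = (U1 :\ s) :|: U2.
    by rewrite setDUl; congr (_ :|: _); apply/setDidPl; rewrite disjoint_sym disjoints1.
  rewrite IH; [|by move: lek; rewrite (cardsD1 s U1) sU1
    |by move=> x; rewrite inE => /andP[_ /z1]|exact: z2].
  rewrite (cardsD1 s U1) sU1 /= mulrnAr -mulrA; congr (_ * _ *+ _).
  (* The free space [z] to the right of [s] rules out criticality on both sides, and no space of
     [U2] lies to the left of [s]. *)
  have sz := z1 _ sU1; apply: park_weight_eq => [p ps|]; last first.
    by split=> /(_ z sz); rewrite !inE (negbTE zO1) ?(negbTE zO2) andbF.
  split=> h y ys; have := h y ys; rewrite !inE; last by move=> ->.
  case/orP=> // /z2; case/andP: ys; lia.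
have -> : \sum_(s in U2) park_weight ((U1 :|: U2) :\ s) s * fill_sum ((U1 :|: U2) :\ s)
  = (fill_sum U1 * fill_sum U2) *+ 'C((#|U1| + #|U2|).-1, #|U1|).
  have [e|U2n] := eqVneq U2 set0.
    rewrite e big_set0 cards0 addn0 bin_small ?mulr0n // prednK //.
    by move: nz; rewrite e cards0 addn0.
  rewrite (fill_sumE U2n) mulr_sumr -sumrMnl; apply: eq_bigr => s sU2.
  have s1 : s \notin U1 by rewrite (disjointFl disj sU2).
  have -> : (U1 :|: U2) :\ s = U1 :|: (U2 :\ s).
    by rewrite setDUl; congr (_ :|: _); apply/setDidPl; rewrite disjoint_sym disjoints1.
  rewrite IH; [|by move: lek; rewrite (cardsD1 s U2) sU2 addnS
    |exact: z1|by move=> x; rewrite inE => /andP[_ /z2]].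
  rewrite (cardsD1 s U2) sU2 addnS /= mulrnAr mulrCA.
  congr (_ * (_ * _) *+ _).
  have sz := z2 _ sU2; apply: park_weight_eq => [p ps|]; last first.
    split=> h y ys; have := h y ys; rewrite !inE; last by move=> ->; rewrite orbT.
    case/orP=> // /z1; lia.
  split=> h y ys; have := h y ys; rewrite !inE; last by move=> ->; rewrite orbT.
  (* A run of occupied spaces ending before [s] and meeting [U1] would contain [z], which is
     free. *)
  case/orP=> // /z1 yz; have := h z; rewrite !inE (negbTE zO1) (negbTE zO2) andbF.
  have -> : (p <= z < s)%N by case/andP: ys; lia.
  by move=> /(_ isT).
(* The two coefficients add up by Pascal's rule. *)
rewrite -mulrnDr; congr (_ *+ _); case: #|U1| nz => [|a] /=.
  by move=> _; rewrite !bin0.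
by move=> _; rewrite addSn binS addnC.
Qed.

End Filling.

(** * Filling an interval of spaces, and comparison with forests *)

Section Intervals.
Variables (R : comNzRingType) (n : nat) (q : nat -> R) (c : R).

Definition itv a b : {set 'I_n} := [set i : 'I_n | (a <= i < b)%N].

Lemma big_itv (T : Type) (idx : T) (op : Monoid.law idx) a b (F : nat -> T) :
  (b <= n)%N ->
  \big[op/idx]_(s in itv a b) F s = \big[op/idx]_(j < b - a) F (a + j)%N.
Proof.
move=> bn; transitivity (\big[op/idx]_(a <= s < b) F s).
  rewrite (big_nat_widen a b n) // big_geq_mkord.
  by apply: eq_bigl => i; rewrite inE andbC.
rewrite -{1}[a]add0n big_addn big_mkord.
by apply: eq_bigr => j _; rewrite addnC.
Qed.

Lemma card_itv a b : (b <= n)%N -> #|itv a b| = (b - a)%N.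
Proof.
by move=> bn; rewrite -sum1_card (big_itv _ a (fun=> 1%N)) // sum1_card card_ord.
Qed.

Lemma itvD1 a b (s : 'I_n) : s \in itv a b ->
  itv a b :\ s = itv a s :|: itv s.+1 b.
Proof.
rewrite inE => sab; apply/setP => i; rewrite !inE -val_eqE /=.
by move: sab; lia.
Qed.

(** A preference below [a] would itself be a free space before [s], so exactly the preferences from
    [a] to [s] lead to [s], with jumps [s - a] down to 0. *)
Lemma jump_weight_itv a b (s : 'I_n) : s \in itv a b ->
  jump_weight q (itv a b :\ s) s = \sum_(i < (s - a).+1) q i.
Proof.
rewrite inE => sab; have [as_ sb] := andP sab.
rewrite /jump_weight (eq_bigl (fun p => p \in itv a s.+1)); last first.
  move=> p; rewrite inE ltnS; case ps: (p <= s)%N; last by rewrite andbF.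
  rewrite andbT /=; apply/forallP/idP => [h|ap y].
    move: ps; rewrite leq_eqVlt => /orP[/eqP->//|ps].
    by move: (h p); rewrite leqnn ps !inE => /andP[_ /andP[]].
  apply/implyP => /andP[py ys]; rewrite !inE -val_eqE /= ltn_eqF //=.
  by rewrite (leq_trans ap py) (ltn_trans ys sb).
rewrite (big_itv _ a (fun p => q (s - p)%N)) ?ltn_ord // subSn //.
rewrite (reindex_inj rev_ord_inj); apply: eq_bigr => j _; congr q => /=.
by have := ltn_ord j; lia.
Qed.

(** The car parking last, in [a + j], finds exactly the rest of the interval occupied: it may jump
    over 0 to [j] spaces, and it is critical exactly when the interval ends at [n]. The other cars
    are separated by [fill_sumU]. *)
Lemma fill_sum_itv_rec a k : (a + k < n)%N ->
  fill_sum q c (itv a (a + k.+1)) = \sum_(j < k.+1)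
    ((if (a + k.+1)%N == n then c else 1) * (\sum_(i < j.+1) q i) *
     (fill_sum q c (itv a (a + j)) *
      fill_sum q c (itv (a + j).+1 (a + k.+1)))) *+ 'C(k, j).
Proof.
move=> akn; set b := (a + k.+1)%N; have bn : (b <= n)%N by rewrite /b addnS.
have bk : (b - a)%N = k.+1 by rewrite /b; lia.
rewrite fill_sumE; last by rewrite -card_gt0 card_itv // bk.
pose F s := ((if b == n then c else 1) * (\sum_(i < (s - a).+1) q i) *
     (fill_sum q c (itv a s) *
      fill_sum q c (itv s.+1 b))) *+ 'C(k, s - a).
rewrite (eq_bigr (F : 'I_n -> R)) => [|s sab]; last first.
  have := sab; rewrite inE => /andP[as_ sb].
  rewrite /park_weight jump_weight_itv // itvD1 // (@fill_sumU _ _ _ _ s); last 2 first.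
  - by move=> x; rewrite inE => /andP[].
  - by move=> x; rewrite inE => /andP[].
  rewrite /F -!mulrnAr [X in X * _ = _]mulrC; congr (_ * _ * (_ * (_ *+ _))).
    congr (if _ then _ else _); apply/forallP/eqP => [h|bn' y].
      (* If the interval ended before [n], space [b] would be free to the right of [s]. *)
      apply/eqP; rewrite eqn_leq bn /= leqNgt; apply/negP => lt.
      by have := h (Ordinal lt); rewrite !inE /= sb /=; lia.
    by apply/implyP; rewrite !inE; have := ltn_ord y; lia.
  rewrite !card_itv ?(ltnW (ltn_ord _)) //; congr 'C(_, _); move: bk; lia.
rewrite (big_itv _ a F) // bk; apply: eq_bigr => j _.
by rewrite /F addKn.
Qed.

(** Strong induction on [k] through the common recurrence, with [S] and [a] free. An interval ending
    before [n] always leaves a free space on its right, so it has no critical car and its forests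
    are counted with 1 in place of [c]. *)
Lemma forest_sum_fill_sum k (S : {set 'I_n}) a : #|S| = k -> (a + k <= n)%N ->
  forest_sum q S (if (a + k)%N == n then c else 1) = fill_sum q c (itv a (a + k)).
Proof.
have [m] := ubnP k; elim: m k S a => // m IH [|k] S a; rewrite ltnS => km Sk akn.
  have -> : S = set0 by apply/eqP; rewrite -cards_eq0 Sk.
  rewrite forest_sum0; suff -> : itv a (a + 0) = set0 by rewrite fill_sum0.
  by apply/setP => i; rewrite !inE; lia.
rewrite addnS in akn; rewrite fill_sum_itv_rec //.
pose e := (a + k.+1)%N; pose x : R := if e == n then c else 1.
(* [X j] comes from the interval of length [j] starting at [a], which ends before [n]; [Y l] comes
   from the one of length [l] ending at [e], which therefore keeps the factor [x]. *)
rewrite (@forest_sum_rec _ _ _ k S _ (fun j => fill_sum q c (itv a (a + j)))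
  (fun l => fill_sum q c (itv (e - l) e)) Sk).
- apply: eq_bigr => j _; congr (_ * (_ * fill_sum _ _ (itv _ _)) *+ _).
  by rewrite /e; have := ltn_ord j; lia.
- move=> B Bk; rewrite -(IH _ B) //; last by lia.
    by rewrite ifF //; apply/negP => /eqP; lia.
  by lia.
move=> B Bk; have eB : (e - #|B| + #|B|)%N = e by rewrite /e; lia.
by rewrite -/e -{1}eB (IH _ B) ?eB // /e; lia.
Qed.

End Intervals.

(** * Preference sequences of the cars, and splitting off the last car *)

Section Parking.
Variables (R : comNzRingType) (n : nat) (q : nat -> R) (c : R).
Implicit Types (U : {set 'I_n}) (ps qs : seq nat).

Definition list_weight ps : R :=
  \prod_(0 <= i < size ps) (q (jump ps i) * (if critical n ps i then c else 1)).

Lemma jump_rcons ps p i : (i < size ps)%N -> jump (rcons ps p) i = jump ps i.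
Proof. by move=> ip; rewrite /jump spots_rcons !nth_rcons size_spots ip. Qed.

Lemma critical_rcons ps p i : (i < size ps)%N ->
  critical n (rcons ps p) i = critical n ps i.
Proof.
move=> ip; rewrite /critical spots_rcons nth_rcons size_spots ip.
by rewrite -cats1 takel_cat // size_spots ltnW.
Qed.

Lemma list_weight_rcons ps p f : first_free (spots ps) p = f ->
  list_weight (rcons ps p) = list_weight ps * (q (f - p)%N *
    (if all (mem (spots ps)) (iota f.+1 (n - f)) then c else 1)).
Proof.
move=> ff; rewrite /list_weight size_rcons big_nat_recr //=; congr (_ * _).
  by apply: eq_big_nat => i /andP[_ ip]; rewrite jump_rcons ?critical_rcons.
congr (q _ * (if _ then _ else _)).
  by rewrite /jump spots_rcons !nth_rcons size_spots ltnn eqxx ff.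
rewrite /critical spots_rcons nth_rcons size_spots ltnn eqxx ff.
by apply: eq_all => y; rewrite -cats1 -(size_spots ps) take_size_cat.
Qed.

(** Space [i.+1] in the list is element [i] of [U]. The set alone would not see cars parked beyond
    [n], hence the separate bound. *)
Definition occupied qs U :=
  all (geq n) qs && ([set i : 'I_n | i.+1 \in qs] == U).

Definition prefs k (t : k.-tuple 'I_n) : seq nat := [seq i.+1 | i : 'I_n <- t].

Definition parking_sum k U : R :=
  \sum_(t : k.-tuple 'I_n | occupied (spots (prefs t)) U) list_weight (prefs t).

Lemma parking_sum0 U : parking_sum 0 U = (U == set0)%:R.
Proof.
rewrite /parking_sum /occupied (eq_bigl (fun _ => U == set0)) => [|t]; last first.
  rewrite tuple0 /= [RHS]eq_sym.
  suff -> : [set i : 'I_n | i.+1 \in spots (prefs [tuple])] = set0 by [].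
  by apply/setP => i; rewrite !inE.
case: eqP => _; last by rewrite big_pred0.
rewrite (big_pred1 [tuple]) /= => [|t]; last by apply/esym/eqP/tuple0.
by rewrite /list_weight big_geq.
Qed.

Lemma rcons_tuple_bij k :
  bijective (fun tp : k.-tuple 'I_n * 'I_n => [tuple of rcons tp.1 tp.2]).
Proof.
apply: inj_card_bij; last by rewrite card_prod !card_tuple card_ord expnSr.
move=> [t p] [t' p'] /(congr1 val) /= /rcons_inj[e ->]; congr (_, _).
exact: val_inj.
Qed.

Lemma occupied_rcons qs U f (s : 'I_n) : f \notin qs ->
  f = s.+1 -> occupied (rcons qs f) U = (s \in U) && occupied qs (U :\ s).
Proof.
move=> fqs fs; rewrite /occupied all_rcons fs /= ltn_ord /=.
have -> : [set i : 'I_n | i.+1 \in rcons qs s.+1] = s |: [set i : 'I_n | i.+1 \in qs].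
  by apply/setP => i; rewrite !inE mem_rcons inE eqSS.
case: (all _ _); rewrite ?andbF //=.
apply/eqP/andP => [<-|[sU /eqP ->]]; last by rewrite setD1K.
by rewrite setU11 setU1K // inE -fs.
Qed.

Lemma first_free_jump qs U (s : 'I_n) : occupied qs U -> s \notin U ->
  \sum_(p : 'I_n | first_free qs p.+1 == s.+1) q (s.+1 - p.+1)%N
    = jump_weight q U s.
Proof.
case/andP=> _ /eqP <-; rewrite inE => sqs.
apply: eq_big => [p|p _]; last by rewrite subSS.
apply/first_freeP/andP => [[ps _ h]|[ps /forallP h]]; split=> //.
  by apply/forallP => y; apply/implyP => py; rewrite inE; exact: h.
case=> [//|y] py; have yn : (y < n)%N by have := ltn_ord s; case/andP: py; lia.
by have := h (Ordinal yn); rewrite inE => /implyP; exact.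
Qed.

(** Appending a car changes neither the spaces, the jumps nor the criticality of the earlier ones.
    If it takes [s], they occupy [U :\ s], and its possible preferences sum to [park_weight]. *)
Lemma parking_sum_rec k U :
  parking_sum k.+1 U =
  \sum_(s in U) park_weight q c (U :\ s) s * parking_sum k (U :\ s).
Proof.
rewrite /parking_sum (reindex _ (onW_bij _ (rcons_tuple_bij k))) /=.
pose f (tp : k.-tuple 'I_n * 'I_n) := first_free (spots (prefs tp.1)) tp.2.+1.
have prefs_rcons (tp : k.-tuple 'I_n * 'I_n) :
    prefs [tuple of rcons tp.1 tp.2] = rcons (prefs tp.1) tp.2.+1.
  by rewrite /prefs map_rcons.
have f0 tp : (0 < f tp)%N by apply: leq_trans (first_free_ge _ _).
(* The space of the last car, renumbered from 0. The default [tp.2] is returned only when that space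
   lies beyond [n], which [occupied] excludes. *)
pose g (tp : k.-tuple 'I_n * 'I_n) : 'I_n := odflt tp.2 (insub (f tp).-1).
have gE tp : (f tp <= n)%N -> f tp = (g tp).+1.
  move=> fn; rewrite /g; case: insubP => [i _ ei|]; last by rewrite prednK // fn.
  by rewrite -(prednK (f0 tp)) -ei.
under eq_bigl do rewrite prefs_rcons spots_rcons.
have occf tp U' : occupied (rcons (spots (prefs tp.1)) (f tp)) U' -> (f tp <= n)%N.
  by rewrite /occupied all_rcons => /andP[/andP[]].
rewrite (partition_big g (mem (U))) /=; last first.
  move=> tp h; have := h; rewrite (occupied_rcons _ _ (gE _ (occf _ _ h))).
    by case/andP.
  exact: first_free_notin.
apply: eq_bigr => s sU.
rewrite mulr_sumr.
transitivity (\sum_(t : k.-tuple 'I_n | occupied (spots (prefs t)) (U :\ s))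
   \sum_(p : 'I_n | first_free (spots (prefs t)) p.+1 == s.+1)
     list_weight (prefs t) * (q (s.+1 - p.+1)%N *
       (if [forall y : 'I_n, (s < y)%N ==> (y \in U :\ s)] then c else 1))).
  rewrite pair_big_dep /=; apply: eq_big => [tp|tp /andP[h /eqP gs]].
    apply/andP/andP => [[h /eqP gs]|[h /eqP fs]].
      have fs : f tp = s.+1 by rewrite -gs; exact: gE (occf _ _ h).
      move: h; rewrite (occupied_rcons _ _ fs) ?first_free_notin // => /andP[_ ->].
      by rewrite -/(f tp) fs.
    rewrite (occupied_rcons _ _ fs) ?first_free_notin // sU h; split=> //.
    by rewrite -val_eqE /= -eqSS -gE /f fs.
  have fs : f tp = s.+1 by rewrite -gs; exact: gE (occf _ _ h).
  move: h; rewrite (occupied_rcons _ _ fs) ?first_free_notin //.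
  move=> /andP[_ /andP[_ /eqP occE]].
  rewrite prefs_rcons (list_weight_rcons fs); congr (_ * (_ * _)).
  congr (if _ then _ else _); rewrite -occE.
  (* Criticality is tested on spaces numbered from 1 on the left and from 0 on the right, hence the
     predecessor. *)
  apply/allP/forallP => h y; last first.
    rewrite mem_iota => yn; have yn' : (y.-1 < n)%N by move: yn; have := ltn_ord s; lia.
    have := h (Ordinal yn'); rewrite inE /= prednK; last by move: yn; lia.
    by move/implyP; apply; move: yn; lia.
  apply/implyP => sy; rewrite inE; apply: h; rewrite mem_iota.
  by have := ltn_ord y; have := ltn_ord s; lia.
apply: eq_bigr => t occ; rewrite -mulr_sumr -mulr_suml mulrC.
by rewrite (first_free_jump occ) // !inE eqxx.
Qed.

Lemma parking_sumE k U : parking_sum k U = fill_rec q c k U.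
Proof.
elim: k U => [|k IH] U; first exact: parking_sum0.
by rewrite parking_sum_rec /=; apply: eq_bigr => s _; rewrite IH.
Qed.

(** Here [n] distinct spaces between 1 and [n] exhaust [iota 1 n]. *)
Lemma occupied_setT qs : uniq qs -> size qs = n -> all (leq 1) qs ->
  occupied qs setT = all (geq n) qs.
Proof.
move=> uqs sqs pqs; rewrite /occupied; case: allP => //= le_n.
apply/eqP/setP => i; rewrite !inE.
have sub : {subset qs <= iota 1 n}.
  move=> x xq; rewrite mem_iota (allP pqs) //= add1n ltnS; exact: le_n.
have [|_ ->] := uniq_min_size uqs sub; first by rewrite size_iota sqs.
by rewrite mem_iota /= add1n ltnS ltn_ord.
Qed.

End Parking.

(** * From monomials in the statistics to products over vertices and cars *)

Lemma prod_count (R : comNzRingType) (T : Type) n (x : nat -> R) (h : T -> nat)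
    (r : seq T) :
  all (fun y => h y <= n)%N r ->
  \prod_(i < n.+1) x i ^+ count (fun y => h y == i) r = \prod_(y <- r) x (h y).
Proof.
elim: r => [|y r IH] /=; first by rewrite big_nil big1.
case/andP=> hy rh; rewrite big_cons -(IH rh).
under eq_bigr do rewrite exprD; rewrite big_split /=; congr (_ * _).
rewrite (bigD1 (Ordinal (hy : h y < n.+1)%N)) //= eqxx expr1 big1 ?mulr1 // => i.
by rewrite -val_eqE /= eq_sym => /negbTE ->.
Qed.

Lemma prod_if_count (R : comNzRingType) (T : Type) (x : R) (b : pred T) (r : seq T) :
  \prod_(y <- r) (if b y then x else 1) = x ^+ count b r.
Proof. by rewrite -big_mkcond /= big_const_seq iter_mulr_1. Qed.

Theorem theorem5p3 (n : nat) :
  \sum_(f : {ffun 'I_n -> option 'I_n} | is_forest f)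
     ((\prod_(i < n.+1) qvar i ^+ lead f i) * cvar n ^+ tree f)
  = \sum_(g : {ffun 'I_n -> 'I_n} | is_parking_function n (pref_seq g))
     ((\prod_(i < n.+1) qvar i ^+ lucky (pref_seq g) i)
        * cvar n ^+ critic n (pref_seq g)).
Proof.
(* The weights are indexed by all naturals; beyond [n] the value of [inord] is a dummy, and only
   indices at most [n] are matched with [qvar]. *)
pose q k : {mpoly int[n.+2]} := qvar (inord k : 'I_n.+1).
have qE (i : 'I_n.+1) : qvar i = q i by rewrite /q inord_val.
transitivity (forest_sum q [set: 'I_n] (cvar n)).
  apply: eq_big => [f|f _].
    rewrite /forest_on; case: (is_forest f) => //=; apply/esym/forallP => v.
    by case: (f v) => // u; rewrite !inE.
  rewrite big_split /=; congr (_ * _).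
    under eq_bigr do rewrite qE.
    rewrite -[RHS]big_enum enum_setT -(@prod_count _ _ n).
      apply: eq_bigr => i _; congr (_ ^+ _); rewrite /lead cardsE cardE.
      by rewrite size_filter.
    by apply/allP => v _; rewrite /Defs.inv -[X in (_ <= X)%N]card_ord max_card.
  by rewrite -[RHS]big_enum enum_setT prod_if_count /tree cardsE cardE size_filter.
transitivity (parking_sum q (cvar n) n [set: 'I_n]).
  (* The interval of all spaces ends at [n], so the conditional selects [cvar n]. *)
  have := @forest_sum_fill_sum _ n q (cvar n) n setT 0.
  rewrite add0n eqxx => ->; rewrite ?cardsT ?card_ord // parking_sumE.
  suff -> : itv n 0 n = [set: 'I_n] by rewrite /fill_sum cardsT card_ord.
  by apply/setP => i; rewrite !inE ltn_ord.
have bij : bijective (fun t : n.-tuple 'I_n => [ffun i => tnth t i]).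
  apply: inj_card_bij; last by rewrite card_ffun card_tuple card_ord.
  by move=> t t' /ffunP e; apply: eq_from_tnth => i; have := e i; rewrite !ffunE.
rewrite [RHS](reindex _ (onW_bij _ bij)) /=.
have prefsE (t : n.-tuple 'I_n) : pref_seq [ffun i => tnth t i] = prefs t.
  rewrite /pref_seq /prefs -[in RHS](map_tnth_enum t) -map_comp.
  by apply: eq_map => i; rewrite /= ffunE.
have size_prefs (t : n.-tuple 'I_n) : size (prefs t) = n by rewrite size_map size_tuple.
have occE (t : n.-tuple 'I_n) :
    occupied (spots (prefs t)) [set: 'I_n] = is_parking_function n (prefs t).
  have pos : all (leq 1) (prefs t) by apply/allP => _ /mapP[i _ ->].
  rewrite occupied_setT ?spots_uniq ?size_spots ?spots_gt0 //.
  by rewrite /is_parking_function size_prefs eqxx pos.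
apply: eq_big => [t|t]; rewrite prefsE ?occE // -occE => /andP[le_n _].
rewrite /list_weight big_split /= /index_iota subn0; congr (_ * _).
  under [RHS]eq_bigr do rewrite qE.
  rewrite prod_count //; apply/allP => i; rewrite mem_iota add0n => /= ip.
  by apply: leq_trans (leq_subr _ _) _; apply: (allP le_n); rewrite mem_nth // size_spots.
exact: prod_if_count.
Qed.
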